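(* Let $G$ be a finite abelian group (written additively) and let $\mathbb{F}$ be an algebraically closed field whose characteristic does not divide $|G|$. Then $\beta_{\mathrm{sep}}(G)$ is the minimal positive integer $d$ such that for any positive integer $s\le\kappa(G)$ and any finite sequence $a_1,\dots,a_s$ of distinct elements of $G$, the abelian group $\mathcal{G}(a_1,\dots,a_s)$ is generated by $\{m\in\mathcal{B}(a_1,\dots,a_s): |m|\le d\}$.
   Context: A $G$-module is a finite dimensional $\mathbb{F}$-vector space $V$ with a linear action of $G$. $\mathcal{O}(V)$ is the coordinate ring of $V$ (a polynomial algebra with its standard grading), and $\mathcal{O}(V)^G=\{f\in\mathcal{O}(V): f(gv)=f(v)\ \forall v\in V, g\in G\}$. A subset $S\subset\mathcal{O}(V)^G$ is a separating set if whenever $v,w\in V$ satisfy $f(v)=f(w)$ for all $f\in S$, then $h(v)=h(w)$ for all $h\in\mathcal{O}(V)^G$. $\beta_{\mathrm{sep}}(G,V)$ is the minimal positive integer $d$ such that $\mathcal{O}(V)^G$ contains a separating set consisting of homogeneous elements of degree at most $d$, and $\beta_{\mathrm{sep}}(G)=\sup_V\beta_{\mathrm{sep}}(G,V)$ over all $G$-modules $V$. For a sequence $a_1,\dots,a_s$ in $G$, $\mathcal{G}(a_1,\dots,a_s)=\{m\in\mathbb{Z}^s:\sum_i m_ia_i=0\in G\}$, $\mathcal{B}(a_1,\dots,a_s)=\mathbb{N}_0^s\cap\mathcal{G}(a_1,\dots,a_s)$, and $|m|=\sum_i m_i$. The Helly dimension $\kappa(G)$ is the minimal positive integer $k$ such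 that any set of cosets (of subgroups) in $G$ with empty intersection contains a subset of at most $k$ cosets with empty intersection. It is known that for a finite abelian group $G$, $\kappa(G)$ is one more than the minimal number of generators of $G$. *)

(* Defs.v *)
From mathcomp Require Import all_boot all_order all_algebra all_fingroup.
From mathcomp Require Import mxrepresentation.
From mathcomp Require Export mpoly.

Set Implicit Arguments.
Unset Strict Implicit.
Unset Printing Implicit Defensive.

Import GRing.Theory Num.Theory.
Local Open Scope ring_scope.

Definition min_positive (P : nat -> Prop) (d : nat) : Prop :=
  [/\ (0 < d)%N, P d & forall e : nat, (0 < e)%N -> P e -> (d <= e)%N].

Section SeparatingNoether.

Variables (F : fieldType) (gT : finGroupType) (G : {group gT}).

Section Module.

(* Up to isomorphism a G-module is F^n with G acting by [v |-> rG g *m v] on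
   column vectors. For F infinite, polynomials in n variables and polynomial
   functions on F^n are the same thing, so O(V) is {mpoly F[n]}. *)
Variables (n : nat) (rG : mx_representation F G n).

Definition eval_at (f : {mpoly F[n]}) (v : 'cV[F]_n) : F :=
  f.@[fun i => v i 0].

Definition invariant_poly (f : {mpoly F[n]}) : Prop :=
  forall (g : gT) (v : 'cV[F]_n), g \in G ->
    eval_at f (rG g *m v) = eval_at f v.

Definition separating_set (S : {mpoly F[n]} -> Prop) : Prop :=
  (forall f, S f -> invariant_poly f) /\
  forall v w : 'cV[F]_n,
    (forall f, S f -> eval_at f v = eval_at f w) ->
    forall h, invariant_poly h -> eval_at h v = eval_at h w.

Definition has_separating_set_of_degree (d : nat) : Prop :=
  exists S : {mpoly F[n]} -> Prop,
    separating_set S /\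
    forall f, S f -> exists2 e : nat, (e <= d)%N & f \is e.-homog.

Definition is_beta_sep_module (d : nat) : Prop :=
  min_positive has_separating_set_of_degree d.

End Module.

Definition beta_sep_bound (d : nat) : Prop :=
  forall (n : nat) (rG : mx_representation F G n),
    exists2 b : nat, is_beta_sep_module rG b & (b <= d)%N.

(* [d] is the supremum, in the extended naturals, of the separating Noether
   numbers of all G-modules; no [d] qualifies if that supremum is infinite. *)
Definition is_beta_sep (d : nat) : Prop :=
  beta_sep_bound d /\ forall e : nat, beta_sep_bound e -> (d <= e)%N.

End SeparatingNoether.

Section Helly.

Variable gT : finGroupType.

Definition is_coset (C : {set gT}) : bool :=
  [exists H : {group gT}, exists x : gT, C == (x *: H)%g].

(* The empty intersection is the whole group. *)
Definition helly_property (k : nat) : bool :=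
  [forall X : {set {set gT}},
     [forall C in X, is_coset C] && (\bigcap_(C in X) C == set0) ==>
     [exists Y : {set {set gT}},
        [&& Y \subset X, (#|Y| <= k)%N & \bigcap_(C in Y) C == set0]]].

Fact helly_property_exists : exists k, (0 < k)%N && helly_property k.
Proof.
exists #|{set gT}|.+1; apply/andP; split=> //.
apply/forallP=> X; apply/implyP=> /andP[_ X0].
apply/existsP; exists X; rewrite subxx X0 andbT /=.
exact: leq_trans (max_card _) (leqnSn _).
Qed.

Definition helly_dim : nat := ex_minn helly_property_exists.

End Helly.

Section Relations.

Variables (A : zmodType) (s : nat) (a : s.-tuple A).

Definition relation_group (m : {ffun 'I_s -> int}) : Prop :=
  \sum_(i < s) tnth a i *~ m i = 0.

Definition relation_monoid (m : {ffun 'I_s -> int}) : Prop :=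
  (forall i, 0 <= m i) /\ relation_group m.

Definition ffun_length (m : {ffun 'I_s -> int}) : int := \sum_(i < s) m i.

End Relations.

Definition is_subgroup (V : zmodType) (H : V -> Prop) : Prop :=
  H 0 /\ forall x y, H x -> H y -> H (x - y).

Definition generated_subgroup (V : zmodType) (T : V -> Prop) (x : V) : Prop :=
  forall H : V -> Prop, is_subgroup H -> (forall y, T y -> H y) -> H x.

Definition relations_generated (A : zmodType) (k d : nat) : Prop :=
  forall (s : nat) (a : s.-tuple A), (0 < s <= k)%N -> uniq a ->
    forall m : {ffun 'I_s -> int},
      relation_group a m <->
      generated_subgroup
        (fun b => relation_monoid a b /\ ffun_length b <= d%:Z) m.

(* Main.v *)
(* Fix a perfect pairing b : G * G -> F^*.  It identifies G with its group of
   characters, so that a G-module is, up to a change of coordinates, a sequence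
   a_1, ..., a_n in G, and the monomial x^m is invariant iff m is a relation
   between the a_i.

   If the short relations generate all relations, two vectors y, z that are not
   separated in degree at most d have the same support, and the ratios
   u_i = z_i / y_i satisfy every relation between at most kappa distinct a_i.
   By duality any kappa of the equations b(a_i, g) = u_i have a common solution
   g, so Helly's property yields g in G with z = g y.

   Conversely, let H be the subgroup generated by the short relations of a.
   Separating 0 from the i-th basis vector forces the order of a_i to be at most
   d, so |G| kills Z^s / H; if a relation m is not in H, a character of Z^s / H
   that is nontrivial at m is a point u of (F^* )^s which no invariant of degree
   at most d separates from (1, ..., 1), while a monomial invariant does. *)

Require Import Defs.
From mathcomp Require Import all_boot all_order all_algebra all_fingroup.
From mathcomp Require Import all_solvable all_field mxrepresentation.
From Stdlib Require Import Classical.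

Set Implicit Arguments.
Unset Strict Implicit.
Unset Printing Implicit Defensive.

Import GRing.Theory.
Local Open Scope ring_scope.

(** * Characters and pairings of finite abelian groups *)

(** Translation by [x0] permutes [K], so the sum is unchanged by the factor [chi x0], which differs
    from 1 in a domain. *)
Lemma sum_char_eq0 (A : finZmodType) (R : idomainType) (K : {set A})
    (chi : A -> R) (x0 : A) :
    {morph chi : x y / x + y >-> x * y} ->
    (forall x, (x + x0 \in K) = (x \in K)) -> chi x0 != 1 ->
  \sum_(x in K) chi x = 0.
Proof.
move=> chiD Kx0 chi_x0; apply: contraNeq chi_x0 => nz_sum.
apply/eqP/(mulfI nz_sum); rewrite mulr1 mulr_suml.
rewrite [RHS](reindex_inj (addIr x0)) /=.
by apply: eq_big => [x|x _]; rewrite ?Kx0 ?chiD.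
Qed.

(** The standard form on (Z/(n+1))^s, computed on representatives in [0, n]. Only its residue mod
    n+1 is biadditive, which suffices for exponents of a root of unity of order n+1. *)
Definition row_dot n s (k l : 'rV['I_n.+1]_s) : nat :=
  (\sum_i k ord0 i * l ord0 i)%N.

Lemma row_dotC n s (k l : 'rV['I_n.+1]_s) : row_dot k l = row_dot l k.
Proof. by apply: eq_bigr => i _; rewrite mulnC. Qed.

Lemma row_dotD n s (l k k' : 'rV['I_n.+1]_s) :
  row_dot (k + k') l = row_dot k l + row_dot k' l %[mod n.+1].
Proof.
rewrite /row_dot -big_split /=.
apply: (big_rec2 (fun x y => x = y %[mod n.+1])) => // i x y _ xy.
by rewrite mxE /= -mulnDl -modnDm xy modnDm -modnDml modnMml modnDml.
Qed.

(* The double annihilator theorem for (Z/(n+1))^s: by orthogonality of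
   characters, the sum over l of the characters of k0 + h, h in K, would
   vanish if k0 + K avoided 0, yet it equals #|K| times the number of l
   that annihilate K. *)
Lemma double_annihilator n s (K : {set 'rV['I_n.+1]_s}) k0 :
    0 \in K -> {in K &, forall h h', h - h' \in K} ->
    (forall l, (forall h, h \in K -> n.+1 %| row_dot h l)%N ->
       (n.+1 %| row_dot k0 l)%N) ->
  k0 \in K.
Proof.
move=> K0 KB annK0; have [z prim_z] := C_prim_root_exists (ltn0Sn n).
have KN h : h \in K -> - h \in K by move=> Kh; rewrite -sub0r KB.
have KD h h' : h \in K -> h' \in K -> h + h' \in K.
  by move=> Kh Kh'; rewrite -[h']opprK KB ?KN.
pose chi (l k : 'rV['I_n.+1]_s) := z ^+ row_dot k l.
have chiD l : {morph chi l : k k' / k + k' >-> k * k'}.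
  move=> k k'; rewrite /chi -exprD -(prim_expr_mod prim_z) row_dotD.
  by rewrite (prim_expr_mod prim_z).
have chi1 l k : (chi l k == 1) = (n.+1 %| row_dot k l)%N.
  by rewrite (prim_order_dvd prim_z).
pose ann := [set l | [forall h in K, chi l h == 1]].
have ann0 : 0 \in ann.
  rewrite inE; apply/forall_inP => h _; rewrite chi1 /row_dot.
  by rewrite big1 ?dvdn0 // => i _; rewrite mxE muln0.
pose T := \sum_l \sum_(h in K) chi l (k0 + h).
have T_ann : T = #|K|%:R * #|ann|%:R.
  rewrite /T (bigID (mem ann)) /= [X in _ + X]big1 ?addr0 => [|l]; last first.
    rewrite inE negb_forall_in => /exists_inP[h0 Kh0 chi_h0].
    under eq_bigr => h _ do rewrite chiD.
    rewrite -mulr_sumr (sum_char_eq0 (chiD l) _ chi_h0) ?mulr0 // => x.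
    apply/idP/idP => [Kx|Kx]; last exact: KD.
    by rewrite -[x](addrK h0) KB.
  transitivity (\sum_(l in ann) #|K|%:R : algC); last first.
    by rewrite sumr_const mulr_natr.
  apply: eq_bigr => l /[!inE]/forall_inP chi_l.
  transitivity (\sum_(h in K) 1 : algC); last by rewrite sumr_const.
  apply: eq_bigr => h Kh; rewrite chiD (eqP (chi_l h Kh)) mulr1.
  apply/eqP; rewrite chi1; apply: annK0 => h' Kh'.
  by rewrite -chi1 chi_l.
(* The characters take values in [algC], of characteristic 0, where the cardinals of the nonempty
   sets [K] and [ann] do not vanish. *)
have : T != 0.
  rewrite T_ann mulf_neq0 // Num.Theory.pnatr_eq0 -lt0n; apply/card_gt0P.
    by exists 0.
  by exists 0.
apply: contraNT => notKk0; rewrite /T exchange_big big1 //= => h Kh.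
have nz : k0 + h != 0.
  by apply: contraNneq notKk0 => /eqP; rewrite addr_eq0 => /eqP->; rewrite KN.
have chiDr k : {morph chi^~ k : l l' / l + l' >-> l * l'}.
  by move=> l l'; rewrite /chi ![row_dot k _]row_dotC; apply: chiD.
have /existsP[i nz_i] : [exists i, (k0 + h) ord0 i != 0].
  apply: contraNT nz; rewrite negb_exists => /forallP k0h0.
  by apply/eqP/rowP => i; rewrite [RHS]mxE; apply/eqP/negPn/k0h0.
(* The unit vector at a nonzero coordinate of k0 + h: it pairs with k0 + h to that coordinate, which
   n+1 does not divide, so the character in [l] is nontrivial. *)
pose l0 : 'rV['I_n.+1]_s := \row_j (if j == i then inZp 1 else 0).
transitivity (\sum_(l in [set: 'rV['I_n.+1]_s]) chi l (k0 + h)).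
  by apply: eq_bigl => l; rewrite inE.
apply: (sum_char_eq0 (chiDr (k0 + h)) (x0 := l0)) => [l|]; first by rewrite !inE.
rewrite chi1 /row_dot (bigD1 i) //= [X in (_ + X)%N]big1 => [|j /negPf ji].
  rewrite [l0 _ _]mxE eqxx addn0 /dvdn modnMmr muln1 modn_small //.
by rewrite [l0 _ _]mxE ji muln0.
Qed.

(** The decomposition into cyclic factors, in coordinates; each exponent is determined only modulo
    the order of its generator. *)
Lemma finZmod_basis (A : finZmodType) :
  exists (r : nat) (x : 'I_r -> A) (k : A -> 'I_r -> nat),
    (forall a, a = \sum_i x i *+ k a i) /\
    forall a (c : 'I_r -> nat), a = \sum_i x i *+ c i ->
      forall i, c i = k a i %[mod #[x i]%g].
Proof.
have [b defA _] := abelian_structure (FinRing.zmod_abelian [set: A]).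
pose x (i : 'I_(size b)) := tnth (in_tuple b) i; exists (size b), x.
move: defA; rewrite (big_tnth _ _ b) => defA.
have sumE (c : 'I_(size b) -> nat) :
    (\prod_i (x i ^+ c i))%g = \sum_i x i *+ c i.
  by apply: (big_ind2 (fun u v : A => u = v)) => // u v u' v' -> ->.
have /fin_all_exists[k kP] (a : A) : exists k : 'I_(size b) -> nat,
    a = \sum_i x i *+ k i /\
    forall c : 'I_(size b) -> nat, a = \sum_i x i *+ c i ->
      forall i, c i = k i %[mod #[x i]%g].
  have [e [e_x def_a e_uniq]] := mem_bigdprod defA (in_setT a).
  have /fin_all_exists[k ek] i : exists k, e i = (x i ^+ k)%g.
    exact/cycleP/e_x.
  exists k; split=> [|c]; rewrite -sumE.
    by rewrite {1}def_a; apply: eq_bigr => i _; rewrite ek.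
  move/e_uniq=> c_e i; apply/eqP; rewrite -eq_expg_mod_order -ek.
  by rewrite c_e // => j _; apply: mem_cycle.
by exists k; split=> a *; have [k1 k2] := kP a; [exact: k1 | exact: k2].
Qed.

(** As n is invertible in F, X^n - 1 is separable and has n distinct roots; n distinct n-th roots of
    unity include a primitive one. *)
Lemma closed_prim_root (F : closedFieldType) (n : nat) :
  n%:R != 0 :> F -> exists z : F, n.-primitive_root z.
Proof.
move=> nz_n; have n_gt0 : (0 < n)%N by case: n nz_n => //; rewrite eqxx.
have [rs] := closed_field_poly_normal ('X^n - 1 : {poly F}).
rewrite (monicP (monicXnsubC 1 n_gt0)) scale1r => def_rs.
have Urs : uniq rs.
  by rewrite -separable_prod_XsubC -def_rs separable_Xn_sub_1.
have /hasP[z _ z_prim] : has n.-primitive_root rs.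
  apply: has_prim_root => //.
    apply/allP=> z; rewrite -root_prod_XsubC -def_rs => /rootP.
    by rewrite !hornerE => /eqP; rewrite subr_eq0 unity_rootE.
  by rewrite -ltnS -(size_prod_XsubC rs id) -def_rs size_XnsubC.
by exists z.
Qed.

(** Symmetry carries additivity and nondegeneracy over to the other argument. The last clause is
    what attaches a weight in [A] to each coordinate of a diagonalized representation. *)
Definition perfect_pairing (F : fieldType) (A : zmodType) (b : A -> A -> F) :=
  [/\ forall a x, b a x = b x a,
      forall a, b a 0 = 1,
      forall a, {morph b a : x y / x + y >-> x * y},
      forall a, (forall x, b a x = 1) -> a = 0
    & forall chi : A -> F, chi 0 = 1 -> {morph chi : x y / x + y >-> x * y} ->
        exists a, chi =1 b a].

(* In coordinates with respect to a basis x_i of A, the pairing is the product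
   of the w_i ^ (a_i * c_i), where w_i is a primitive root of unity whose order
   is that of x_i. *)
Lemma perfect_pairing_exists (F : fieldType) (A : finZmodType) (z : F) :
  #|A|.-primitive_root z -> exists b : A -> A -> F, perfect_pairing b.
Proof.
move=> prim_z; have [r [x [k [kE k_uniq]]]] := finZmod_basis A.
pose o i := #[x i]%g; pose w i := z ^+ (#|A| %/ o i).
have xo i : x i *+ o i = 0 by rewrite -FinRing.zmodXgE expg_order.
have prim_w i : (o i).-primitive_root (w i).
  apply: dvdn_prim_root => //; rewrite -cardsT; apply: order_dvdG.
  exact: in_setT.
have kD a c i : k (a + c) i = (k a i + k c i)%N %[mod o i].
  apply/esym/(k_uniq _ (fun j => k a j + k c j)%N).
  rewrite {1}[a]kE {1}[c]kE -big_split /=.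
  by apply: eq_bigr => j _; rewrite mulrnDr.
have k0 i : k 0 i = 0 %[mod o i].
  by apply/esym/(k_uniq _ (fun=> 0)); rewrite big1.
have kx i j : k (x i) j = (j == i) %[mod o j].
  apply/esym/(k_uniq _ (fun j => (j == i) : nat)); rewrite (bigD1 i) //=.
  rewrite eqxx big1 ?addr0 // => l /negPf->.
  exact: mulr0n.
pose b a c := \prod_i w i ^+ (k a i * k c i).
have w_mod i u v v' : v = v' %[mod o i] -> w i ^+ (u * v) = w i ^+ (u * v').
  move=> vv'; rewrite -(prim_expr_mod (prim_w i)) -modnMmr vv' modnMmr.
  exact: prim_expr_mod.
have bD a : {morph b a : c d / c + d >-> c * d}.
  move=> c d; rewrite /b -big_split /=; apply: eq_bigr => i _.
  by rewrite -exprD -mulnDr; apply: w_mod.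
exists b; split=> // [a c|a|a ba1|chi chi0 chiD].
- by apply: eq_bigr => i _; rewrite mulnC.
- by apply: big1 => i _; rewrite (w_mod _ _ _ _ (k0 i)) muln0.
- rewrite [a]kE big1 // => i _; have := ba1 (x i).
  rewrite /b (bigD1 i) //= (w_mod _ _ _ _ (kx i i)) eqxx muln1.
  rewrite big1 ?mulr1 => [/eqP|j /negPf ji]; last first.
    by rewrite (w_mod _ _ _ _ (kx i j)) ji muln0.
  rewrite -(prim_order_dvd (prim_w i)) => /dvdnP[q ->].
  by rewrite mulnC mulrnA xo mul0rn.
have chiX a m : chi (a *+ m) = chi a ^+ m.
  by elim: m => [|m IH]; rewrite ?mulr0n // mulrS chiD IH exprS.
(* A character sends x_i to a root of unity of order dividing [o i], hence to a power of [w i];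
   these exponents are the coordinates of the element representing it. *)
have /fin_all_exists[m chi_x] i : exists m : nat, chi (x i) = w i ^+ m.
  have : chi (x i) ^+ o i = 1.
    by rewrite -chiX xo.
  by move/(prim_rootP (prim_w i))=> [m ->]; exists m.
exists (\sum_i x i *+ m i) => c.
rewrite {1}[c]kE (big_morph chi chiD chi0).
apply: eq_bigr => i _; rewrite chiX chi_x -exprM ![(_ * k c i)%N]mulnC.
exact/w_mod/k_uniq.
Qed.

(** * Subgroups of Z^s and the characters that separate them *)

Lemma exprz_mod (F : fieldType) (u : F) (N : nat) (m m' : int) :
  (0 < N)%N -> u ^+ N = 1 -> (m = m' %[mod N])%Z -> u ^ m = u ^ m'.
Proof.
move=> N_gt0 uN; have nz_u : u != 0.
  by apply: contra_eq_neq uN => ->; rewrite expr0n gtn_eqF // eq_sym oner_neq0.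
suff red k : u ^ k = u ^ (k %% N)%Z by move=> mm'; rewrite red mm' -red.
rewrite {1}(divz_eq k N) expfzDr // mulrC mulrC -[X in X * _]exprz_exp.
by rewrite exprzAC [_ ^ N]uN exp1rz mul1r.
Qed.

Lemma subgroup_opp (V : zmodType) (H : V -> Prop) x :
  is_subgroup H -> H x -> H (- x).
Proof. by move=> [H0 HB] Hx; rewrite -sub0r; apply: HB. Qed.

Lemma subgroup_add (V : zmodType) (H : V -> Prop) x y :
  is_subgroup H -> H x -> H y -> H (x + y).
Proof.
by move=> sgH Hx Hy; rewrite -[y]opprK; apply: (proj2 sgH) => //;
  apply: subgroup_opp.
Qed.

Lemma subgroup_mulrz (V : zmodType) (H : V -> Prop) x (m : int) :
  is_subgroup H -> H x -> H (x *~ m).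
Proof.
move=> sgH Hx; have Hn n : H (x *+ n).
  elim: n => [|n IH]; first by rewrite mulr0n; apply: (proj1 sgH).
  by rewrite mulrS; apply: subgroup_add.
case: m => n; first exact: Hn.
by rewrite NegzE mulrNz; apply: subgroup_opp => //; apply: Hn.
Qed.

Lemma subgroup_sum (V : zmodType) (H : V -> Prop) (I : finType) (f : I -> V) :
  is_subgroup H -> (forall i, H (f i)) -> H (\sum_i f i).
Proof.
move=> sgH Hf; elim/big_ind: _ => // [|x y]; first exact: (proj1 sgH).
exact: subgroup_add.
Qed.

Definition ffun_delta s (i : 'I_s) (c : int) : {ffun 'I_s -> int} :=
  [ffun j => if j == i then c else 0].

(** A subgroup containing N Z^s is a union of residue classes: m' - m is the combination of the N
    e_i with coefficients (m'_i - m_i) / N. *)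
Lemma subgroup_congr s (H : {ffun 'I_s -> int} -> Prop) (N : nat)
    (m m' : {ffun 'I_s -> int}) :
    is_subgroup H -> (forall i, H (ffun_delta i N)) ->
    (forall i, (m i = m' i %[mod N])%Z) ->
  H m -> H m'.
Proof.
move=> sgH HN mm' Hm; rewrite -[m'](subrK m) addrC.
apply: subgroup_add => //.
have -> : m' - m = \sum_i ffun_delta i N *~ ((m' i - m i) %/ N)%Z.
  apply/ffunP => j; rewrite sum_ffunE (bigD1 j) //= big1 => [|i /negPf ij].
    rewrite addr0 -[RHS]/((_ *~ _ : {ffun _ -> _}) j) ffunMzE !ffunE eqxx.
    by rewrite -mulrzr intz mulrC divzK // -eqz_mod_dvd; apply/eqP.
  by rewrite ffunMzE ffunE eq_sym ij mul0rz.
by apply: subgroup_sum => // i; apply: subgroup_mulrz.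
Qed.

Definition lift_row n s (k : 'rV['I_n.+1]_s) : {ffun 'I_s -> int} :=
  [ffun i => (k ord0 i)%:Z].

Definition mod_row n s (m : {ffun 'I_s -> int}) : 'rV['I_n.+1]_s :=
  \row_i inZp `|(m i %% n.+1)%Z|%N.

Lemma lift_mod_row n s (m : {ffun 'I_s -> int}) i :
  (lift_row (mod_row n m) i = m i %[mod n.+1])%Z.
Proof.
rewrite ffunE mxE /= modz_nat modn_mod -modz_nat gez0_abs ?modz_mod //.
exact: modz_ge0.
Qed.

Lemma lift_rowB n s (k k' : 'rV['I_n.+1]_s) i :
  (lift_row (k - k') i = (lift_row k - lift_row k') i %[mod n.+1])%Z.
Proof.
have := congr1 val (subrK (k' ord0 i) (k ord0 i)); rewrite !ffunE !mxE /= => e.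
apply/eqP; rewrite -(eqz_modDr (k' ord0 i)%:Z) subrK -PoszD !modz_nat.
by rewrite -[X in _ == Posz (X %% _)]e modn_mod.
Qed.

Lemma exp_lift_row (F : fieldType) (z : F) n s (k l : 'rV['I_n.+1]_s) :
  \prod_i (z ^+ l ord0 i) ^ lift_row k i = z ^+ row_dot k l.
Proof.
rewrite expr_sum; apply: eq_bigr => i _.
by rewrite ffunE -exprnP -exprM mulnC.
Qed.

(** Since H contains N Z^s, it is the preimage of a subgroup of (Z/N)^s. If m0 is outside, the
    double annihilator theorem gives an [l] that kills this subgroup but not m0, and u_i =
    z^(l_i). *)
Lemma separating_character (F : fieldType) (z : F) (N s : nat)
    (H : {ffun 'I_s -> int} -> Prop) (m0 : {ffun 'I_s -> int}) :
    N.-primitive_root z -> is_subgroup H ->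
    (forall i, H (ffun_delta i N)) -> ~ H m0 ->
  exists u : 'I_s -> F, [/\ forall i, u i != 0,
    forall m, H m -> \prod_i u i ^ m i = 1 & \prod_i u i ^ m0 i != 1].
Proof.
move=> prim_z sgH HN notHm0; have N_gt0 := prim_order_gt0 prim_z.
case: N N_gt0 prim_z HN => // n _ prim_z HN.
(* Excluded middle on the finitely many residue rows turns the proposition H into a finite set. *)
have /fin_all_exists[p pP] (k : 'rV['I_n.+1]_s) :
    exists c : bool, c <-> H (lift_row k).
  by have [Hk|Hk] := classic (H (lift_row k)); [exists true | exists false].
pose K := [set k | p k].
have KP k : reflect (H (lift_row k)) (k \in K).
  by rewrite inE; apply: (iffP idP) => /pP.
have [|] := boolP [exists l, [forall h in K, (n.+1 %| row_dot h l)%N] &&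
                             ~~ (n.+1 %| row_dot (mod_row n m0) l)%N].
  case/existsP=> l /andP[/forall_inP annl nann]; exists (fun i => z ^+ l ord0 i).
  have zN i : (z ^+ l ord0 i) ^+ n.+1 = 1.
    by rewrite exprAC (prim_expr_order prim_z) expr1n.
  have expE (m : {ffun 'I_s -> int}) :
      \prod_i (z ^+ l ord0 i) ^ m i = z ^+ row_dot (mod_row n m) l.
    rewrite -exp_lift_row; apply: eq_bigr => i _.
    by apply: exprz_mod (zN i) _; rewrite ?lift_mod_row.
  split=> [i|m Hm|].
  - by apply: contra_eq_neq (zN i) => ->; rewrite expr0n /= eq_sym oner_neq0.
  - rewrite expE; apply/eqP; rewrite -(prim_order_dvd prim_z).
    apply/annl/KP; apply: (subgroup_congr sgH HN) Hm => i.
    exact/esym/lift_mod_row.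
  by rewrite expE -(prim_order_dvd prim_z).
rewrite negb_exists => /forallP annK; case: notHm0.
apply: (subgroup_congr sgH HN (lift_mod_row n m0)); apply/KP.
apply: double_annihilator => [|h h' /KP Hh /KP Hh'|l annl].
- apply/KP; suff -> : lift_row (0 : 'rV['I_n.+1]_s) = 0 by case: sgH.
  by apply/ffunP => i; rewrite !ffunE mxE.
- apply/KP; apply: (subgroup_congr sgH HN) (proj2 sgH _ _ Hh Hh') => i.
  exact/esym/lift_rowB.
have := annK l; rewrite negb_and negbK => /orP[|//].
by rewrite negb_forall_in => /exists_inP[h /annl ->].
Qed.

(** * Systems of equations in a perfect pairing *)

Lemma pairing_mulrn (F : fieldType) (A : zmodType) (b : A -> A -> F) x k y :
  perfect_pairing b -> b (x *+ k) y = b x y ^+ k.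
Proof.
move=> [bC b0 bD _ _]; elim: k => [|k IH]; first by rewrite mulr0n bC b0.
by rewrite mulrS bC bD bC exprS -IH [b y _]bC.
Qed.

Lemma pairing_sum (F : fieldType) (A : zmodType) (b : A -> A -> F) (I : finType)
    (a : I -> A) (m : I -> nat) g :
  perfect_pairing b -> b (\sum_i a i *+ m i) g = \prod_i b (a i) g ^+ m i.
Proof.
move=> pb; have [bC b0 bD _ _] := pb; rewrite bC (big_morph _ (bD g) (b0 g)).
by apply: eq_bigr => i _; rewrite bC pairing_mulrn.
Qed.

Lemma mulrn_eq0_order (A : finZmodType) (x : A) k :
  (x *+ k == 0) = (#[x]%g %| k)%N.
Proof. by rewrite order_dvdn FinRing.zmodXgE. Qed.

Lemma mulrn_card (A : finZmodType) (x : A) : x *+ #|A| = 0.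
Proof.
by apply/eqP; rewrite mulrn_eq0_order -cardsT order_dvdG // in_setT.
Qed.

(** In exponents of z, the vectors (b(a_i, g))_i form a subgroup of (Z/N)^s. By nondegeneracy its
    annihilators are relations between the a_i, so u satisfies them and the double annihilator
    theorem places u in the subgroup. *)
Lemma pairing_realizes (F : fieldType) (A : finZmodType) (b : A -> A -> F) (z : F)
    (s : nat) (a : 'I_s -> A) (u : 'I_s -> F) :
    #|A|.-primitive_root z -> perfect_pairing b ->
    (forall m : 'I_s -> nat, \sum_i a i *+ m i = 0 -> \prod_i u i ^+ m i = 1) ->
  exists g, forall i, b (a i) g = u i.
Proof.
move=> prim_z pb relu; have [bC b0 bD nondeg _] := pb.
have N_gt0 := prim_order_gt0 prim_z; set N := #|A| in N_gt0 prim_z.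
have expN x y : b x y ^+ N = 1.
  by rewrite -(pairing_mulrn x N y pb) mulrn_card bC b0.
(* N times a_i is 0, so the hypothesis applies to N e_i. *)
have uN i : u i ^+ N = 1.
  have := relu (fun j => if j == i then N else 0%N).
  rewrite (bigD1 i) //= eqxx mulrn_card big1 => [|j /negPf->//]; rewrite addr0.
  move/(_ erefl); rewrite (bigD1 i) //= eqxx big1 ?mulr1 // => j /negPf->.
  by rewrite expr0.
case: {-1}N (erefl N) N_gt0 prim_z => // n defN _ prim_z; rewrite defN in expN uN.
have /fin_all_exists[c cE] g : exists c : 'rV['I_n.+1]_s,
    forall i, b (a i) g = z ^+ c ord0 i.
  have /fin_all_exists[c cE] i : exists k : 'I_n.+1, b (a i) g = z ^+ k.
    by have [k ->] := prim_rootP prim_z (expN (a i) g); exists k.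
  by exists (\row_i c i) => i; rewrite mxE cE.
have /fin_all_exists[l lE] i : exists k : 'I_n.+1, u i = z ^+ k.
  by have [k ->] := prim_rootP prim_z (uN i); exists k.
pose K := [set c g | g in A].
have zB (x y : 'I_n.+1) : z ^+ (x - y)%R * z ^+ y = z ^+ x.
  rewrite -exprD -[in RHS](subrK y x) -(prim_expr_mod prim_z).
  by rewrite -[in RHS](prim_expr_mod prim_z) /= modn_mod.
have z_inj (x y : 'I_n.+1) : z ^+ x = z ^+ y -> x = y.
  move/eqP; rewrite (eq_prim_root_expr prim_z) !modn_small // => /eqP.
  exact: val_inj.
have : \row_i l i \in K.
  apply: double_annihilator => [|h h' /imsetP[g _ ->] /imsetP[g' _ ->]|k annk].
  - apply/imsetP; exists 0 => //; apply/rowP=> i; apply: z_inj.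
    by rewrite -cE b0 mxE.
  - apply/imsetP; exists (g - g') => //; apply/rowP => i; apply: z_inj.
    have nz_z : z ^+ c g' ord0 i != 0.
      apply: contra_eq_neq (expN (a i) g') => eq0.
      by rewrite cE eq0 expr0n eq_sym oner_neq0.
    by apply: (mulIf nz_z); rewrite !mxE zB -!cE -bD subrK.
  have /relu : \sum_i a i *+ k ord0 i = 0.
    apply: nondeg => g; rewrite (pairing_sum _ _ _ pb).
    transitivity (z ^+ row_dot (c g) k); last first.
      by apply/eqP; rewrite -(prim_order_dvd prim_z) annk //; apply: imset_f.
    by rewrite expr_sum; apply: eq_bigr => i _; rewrite cE exprM.
  rewrite (prim_order_dvd prim_z) expr_sum => eq1.
  apply/eqP; rewrite -[RHS]eq1; apply: eq_bigr => i _.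
  by rewrite mxE exprM lE.
case/imsetP=> g _ /rowP lc; exists g => i.
by rewrite cE lE; move: (lc i); rewrite mxE => ->.
Qed.

(** * Separating sets yield generators *)

Lemma relation_is_subgroup (A : zmodType) s (a : s.-tuple A) :
  is_subgroup (relation_group a).
Proof.
split=> [|m m' rel_m rel_m']; rewrite /relation_group.
  by rewrite big1 // => i _; rewrite ffunE mulr0z.
transitivity (\sum_(i < s) (tnth a i *~ m i - tnth a i *~ m' i)).
  by apply: eq_bigr => i _; rewrite !ffunE mulrzBr.
by rewrite sumrB rel_m rel_m' subrr.
Qed.

Lemma generated_is_subgroup (V : zmodType) (T : V -> Prop) :
  is_subgroup (generated_subgroup T).
Proof.
split=> [H [] //|x y Hx Hy H sgH TH]; apply: (proj2 sgH).
  exact: Hx.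
exact: Hy.
Qed.

Definition short_relations (A : zmodType) s (a : s.-tuple A) (d : nat) :
    {ffun 'I_s -> int} -> Prop :=
  generated_subgroup (fun b => relation_monoid a b /\ ffun_length b <= d%:Z).

Lemma short_relations_sub (A : zmodType) s (a : s.-tuple A) d m :
  short_relations a d m -> relation_group a m.
Proof.
by apply=> [|m' [[_ rel_m'] _]//]; apply: relation_is_subgroup.
Qed.

Definition nat_relation (A : zmodType) (I : finType) (a : I -> A)
  (m : I -> nat) : Prop := \sum_i a i *+ m i = 0.

Definition monom_val (R : pzSemiRingType) (I : finType) (v : I -> R)
  (m : I -> nat) : R := \prod_i v i ^+ m i.

(** * Invariants of a diagonal action *)

Section DiagonalRepresentation.

Variables (F : fieldType) (A : finZmodType) (b : A -> A -> F).
Hypotheses (pb : perfect_pairing b) (nz_A : #|A|%:R != 0 :> F).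
Variables (n : nat) (a : 'I_n -> A).

Lemma diag_pairing_mx_repr :
  mx_repr [set: A] (fun g => diag_mx (\row_i b (a i) g)).
Proof.
have [_ b0 bD _ _] := pb; split=> [|g h _ _].
  by apply/matrixP=> i j; rewrite !mxE b0.
rewrite mulmx_diag; congr diag_mx; apply/rowP=> i.
by rewrite !mxE -bD.
Qed.

Definition diag_pairing_repr := MxRepresentation diag_pairing_mx_repr.

Lemma eval_diag_pairing f g v :
  eval_at f (diag_pairing_repr g *m v) = f.@[fun i => b (a i) g * v i 0].
Proof.
by apply: meval_eq => i; rewrite /= mul_diag_mx !mxE.
Qed.

(** Averaging f(g v) over g multiplies each monomial by a character sum, which vanishes unless the
    weight of the monomial is 0; the factor #|A| is then cancelled. *)
Lemma invariant_eval (f : {mpoly F[n]}) v :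
    invariant_poly diag_pairing_repr f ->
  eval_at f v = \sum_(m <- msupp f | \sum_i a i *+ m i == 0)
                   f@_m * monom_val (fun i => v i 0) m.
Proof.
have [bC b0 bD nondeg _] := pb.
move=> inv_f; apply: (mulfI nz_A).
transitivity (\sum_(g : A) eval_at f v).
  by rewrite sumr_const mulr_natl.
transitivity (\sum_(g : A) \sum_(m <- msupp f)
    f@_m * monom_val (fun i => v i 0) m * b (\sum_i a i *+ m i) g).
  apply: eq_bigr => g _; rewrite -(inv_f g v (in_setT g)) eval_diag_pairing.
  rewrite mevalE; apply: eq_bigr => m _; rewrite -mulrA; congr (_ * _).
  rewrite (pairing_sum _ _ _ pb) mulrC -big_split.
  by apply: eq_bigr => i _; rewrite exprMn.
rewrite exchange_big [in RHS]big_mkcond mulr_sumr /=; apply: eq_bigr => m _.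
rewrite -mulr_sumr; case: eqP => [->|/eqP rel_m].
  under eq_bigr => g _ do rewrite bC b0.
  by rewrite sumr_const mulrC.
have /existsP[g0 g0P] : [exists g, b (\sum_i a i *+ m i) g != 1].
  apply: contraNT rel_m; rewrite negb_exists => /forallP b1.
  by apply/eqP/nondeg => g; apply/eqP/negPn/b1.
transitivity (f@_m * monom_val (fun i => v i 0) m *
  \sum_(g in [set: A]) b (\sum_i a i *+ m i) g).
  by congr (_ * _); apply: eq_bigl => g; rewrite inE.
by rewrite (sum_char_eq0 (bD _) _ g0P) ?mulr0 // => g; rewrite !inE.
Qed.

Lemma monomial_invariant (m : 'X_{1..n}) :
  nat_relation a m -> invariant_poly diag_pairing_repr 'X_[m].
Proof.
have [bC b0 _ _ _] := pb.
move=> rel_m g v _; rewrite eval_diag_pairing /eval_at !mevalX.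
under eq_bigr => i _ do rewrite exprMn.
by rewrite big_split /= -(pairing_sum _ _ _ pb) rel_m bC b0 mul1r.
Qed.

(** A homogeneous invariant of degree at most d takes values that are combinations of invariant
    monomials of degree at most d, so agreement on these forces agreement on [S]. *)
Lemma separating_monomials d (v w : 'I_n -> F) :
    has_separating_set_of_degree diag_pairing_repr d ->
    (forall m : 'I_n -> nat, nat_relation a m -> (\sum_i m i <= d)%N ->
       monom_val v m = monom_val w m) ->
  forall m : 'I_n -> nat, nat_relation a m -> monom_val v m = monom_val w m.
Proof.
move=> [S [[invS sepS] degS]] vw m rel_m.
pose M : 'X_{1..n} := [multinom m i | i < n].
have ME i : M i = m i by rewrite mnmE.
have relM : nat_relation a M.
  by rewrite /nat_relation -[RHS]rel_m; apply: eq_bigr => i _; rewrite ME.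
have evalM (u : 'I_n -> F) : eval_at 'X_[M] (\col_i u i) = monom_val u m.
  by rewrite /eval_at mevalX; apply: eq_bigr => i _; rewrite mxE ME.
rewrite -!evalM; apply: sepS (monomial_invariant relM) => f Sf.
have [e e_d homf] := degS f Sf.
rewrite !invariant_eval; try exact: invS.
rewrite big_seq_cond [RHS]big_seq_cond; apply: eq_bigr => k /andP[supp_k /eqP rel_k].
have evalk (u : 'I_n -> F) :
    monom_val (fun i => (\col_j u j : 'cV_n) i 0) k = monom_val u k.
  by apply: eq_bigr => i _; rewrite mxE.
rewrite !evalk vw // -mdegE.
by rewrite (dhomog_mf homf supp_k).
Qed.

End DiagonalRepresentation.

Lemma relation_delta (A : finZmodType) s (a : s.-tuple A) i (c : nat) :
  relation_group a (ffun_delta i c) <-> tnth a i *+ c = 0.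
Proof.
rewrite /relation_group (bigD1 i) //= big1 => [|j /negPf ji].
  by rewrite ffunE eqxx addr0.
by rewrite ffunE ji mulr0z.
Qed.

Lemma short_nat_relation (A : zmodType) s (a : s.-tuple A) d (k : 'I_s -> nat) :
    nat_relation (tnth a) k -> (\sum_i k i <= d)%N ->
  short_relations a d [ffun i => (k i)%:Z].
Proof.
move=> rel_k k_le H _; apply; split; [split=> [i|]|].
- by rewrite ffunE.
- by rewrite /relation_group -[RHS]rel_k; apply: eq_bigr => i _; rewrite ffunE.
rewrite /ffun_length; under eq_bigr => i _ do rewrite ffunE.
by rewrite -(big_morph Posz PoszD erefl).
Qed.

Lemma short_delta (A : finZmodType) s (a : s.-tuple A) d i :
  (#[tnth a i]%g <= d)%N -> short_relations a d (ffun_delta i #|A|).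
Proof.
move=> le_d; have /dvdnP[q ->] : (#[tnth a i]%g %| #|A|)%N.
  by rewrite -mulrn_eq0_order mulrn_card.
have -> : ffun_delta i (q * #[tnth a i]%g)%N = ffun_delta i #[tnth a i]%g *~ q.
  apply/ffunP => j; rewrite ffunMzE !ffunE; case: eqP => _.
    by rewrite -mulrzr intz PoszM mulrC.
  by rewrite mul0rz.
apply: (subgroup_mulrz q (generated_is_subgroup _)).
have -> : ffun_delta i #[tnth a i]%g =
          [ffun j => Posz (if j == i then #[tnth a i]%g else 0%N)].
  by apply/ffunP=> j; rewrite !ffunE; case: eqP.
apply: short_nat_relation.
  rewrite /nat_relation (bigD1 i) //= eqxx big1 => [|j /negPf->//].
  by rewrite -FinRing.zmodXgE expg_order addr0.
rewrite (bigD1 i) //= eqxx big1 => [|j /negPf->//].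
by rewrite addn0.
Qed.

(** Reduction modulo #|A|, which kills [A], turns an integral relation into the exponent of an
    actual monomial. *)
Lemma relation_residues (A : finZmodType) s (a : s.-tuple A) m :
    relation_group a m ->
  exists k : 'I_s -> nat, [/\ forall i, (k i < #|A|)%N,
    nat_relation (tnth a) k & forall i, (k i = m i %[mod #|A|])%Z].
Proof.
move=> rel_m; have A_gt0 : (0 < #|A|)%N by apply/card_gt0P; exists 0.
pose k i := `|(m i %% #|A|)%Z|%N.
have kE i : k i = (m i %% #|A|)%Z :> int.
  by apply: gez0_abs; apply: modz_ge0; rewrite eqz_nat -lt0n.
exists k; split=> [i||i]; last by rewrite kE modz_mod.
  by rewrite -ltz_nat kE ltz_pmod.
have : relation_group a [ffun i => (k i)%:Z].
  apply: subgroup_congr (relation_is_subgroup a) _ _ rel_m => [i|i].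
    exact/relation_delta/mulrn_card.
  by rewrite ffunE kE modz_mod.
by rewrite /relation_group; under eq_bigr => i _ do rewrite ffunE.
Qed.

Lemma relations_generated_of_separating (F : fieldType) (A : finZmodType)
    (b : A -> A -> F) (z : F) (s d : nat) (a : s.-tuple A) (m : {ffun 'I_s -> int}) :
    #|A|.-primitive_root z -> perfect_pairing b -> #|A|%:R != 0 :> F ->
    (forall n (rG : mx_representation F [set: A] n),
       has_separating_set_of_degree rG d) ->
    relation_group a m ->
  short_relations a d m.
Proof.
move=> prim_z pb nz_A sep_d rel_m.
have sepM :=
  separating_monomials nz_A (sep_d s (diag_pairing_repr pb (tnth a))).
(* If d is below the order of a_i, an invariant monomial of degree at most d is constant or involves
   a variable other than x_i. It then agrees at 0 and at the i-th basis vector, while x_i to the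
   power of that order does not. *)
have order_le i : (#[tnth a i]%g <= d)%N.
  rewrite leqNgt; apply/negP => d_lt.
  pose e j := if j == i then #[tnth a i]%g else 0%N.
  have rel_e : nat_relation (tnth a) e.
    rewrite /nat_relation (bigD1 i) //= /e eqxx big1 => [|j /negPf->//].
    by rewrite -FinRing.zmodXgE expg_order addr0.
  have e0 : monom_val (fun=> 0 : F) e = 0.
    apply/eqP/prodf_eq0; exists i => //.
    by rewrite /e eqxx expr0n -leqn0 leqNgt order_gt0.
  have e1 : monom_val (fun j => (j == i)%:R : F) e = 1.
    by apply: big1 => j _; rewrite /e; case: eqP => // _; rewrite expr1n.
  have := sepM (fun=> 0) (fun j => (j == i)%:R) _ e rel_e; rewrite e0 e1.
  move=> absurd; suff /absurd/eqP : forall k : 'I_s -> nat,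
      nat_relation (tnth a) k -> (\sum_j k j <= d)%N ->
      monom_val (fun=> 0 : F) k = monom_val (fun j => (j == i)%:R) k.
    by rewrite eq_sym oner_eq0.
  move=> k rel_k k_le; have [k0|] := boolP [forall j, k j == 0%N].
    by apply: eq_bigr => j _; rewrite (eqP (forallP k0 j)).
  rewrite negb_forall => /existsP[j kj].
  have [/existsP[l /andP[/negPf li kl]]|] :=
      boolP [exists l, (l != i) && (k l != 0%N)].
    transitivity (0 : F).
      by apply/eqP/prodf_eq0; exists l => //; rewrite expr0n (negPf kl).
    by apply/esym/eqP/prodf_eq0; exists l => //; rewrite li expr0n (negPf kl).
  rewrite negb_exists => /forallP k_i.
  have k_i0 l : l != i -> k l = 0%N.
    by move=> li; have := k_i l; rewrite li negbK => /eqP.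
  have ji : j = i by apply: contraNeq kj => /k_i0->.
  move: rel_k; rewrite /nat_relation (bigD1 i) //=.
  rewrite big1 => [|l /k_i0-> //]; rewrite addr0 => /eqP.
  rewrite mulrn_eq0_order => /dvdn_leq k_ge.
  have /k_ge o_le : (0 < k i)%N by rewrite lt0n -ji.
  move: k_le; rewrite (bigD1 i) //= => k_le.
  by have := leq_trans (leq_trans o_le (leq_addr _ _)) k_le; rewrite leqNgt d_lt.
have sgH : is_subgroup (short_relations a d) by apply: generated_is_subgroup.
have H_delta i : short_relations a d (ffun_delta i #|A|) by apply: short_delta.
apply: NNPP => notHm.
have [u [nz_u uH um]] := separating_character prim_z sgH H_delta notHm.
have uN i : u i ^+ #|A| = 1.
  have := uH _ (H_delta i); rewrite (bigD1 i) //= ffunE eqxx big1 ?mulr1 // => j.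
  by rewrite ffunE => /negPf->.
case/eqP: um; have N_gt0 := prim_order_gt0 prim_z.
(* [m] may have negative entries; as u_i^#|A| = 1, its residue [k] has the same value at u and is a
   monomial. *)
have [k [_ rel_k kE]] := relation_residues rel_m.
transitivity (monom_val u k).
  by apply: eq_bigr => i _; rewrite (exprz_mod N_gt0 (uN i) (esym (kE i))).
rewrite -(sepM (fun=> 1) u _ k rel_k).
  by apply: big1 => i _; rewrite expr1n.
move=> l rel_l l_le; transitivity (1 : F).
  by apply: big1 => i _; rewrite expr1n.
rewrite -[LHS](uH _ (short_nat_relation rel_l l_le)); apply: eq_bigr => i _.
by rewrite ffunE.
Qed.

(** * Generators yield separating sets *)

(** The commuting matrices [rG g] are annihilated by X^N - 1 with N = #|A|, which splits with
    distinct roots, so they are diagonalizable together. Each diagonal entry is a character of [A],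
    hence some b(a_i, -). *)
Lemma diagonalize_repr (F : fieldType) (A : finZmodType) (b : A -> A -> F) (z : F)
    n (rG : mx_representation F [set: A] n) :
    #|A|.-primitive_root z -> perfect_pairing b ->
  exists (P : 'M[F]_n) (a : 'I_n -> A), P \in unitmx /\
    forall g, P *m rG g = diag_mx (\row_i b (a i) g) *m P.
Proof.
move=> prim_z pb; pose As := [seq rG g | g <- enum A].
have [|P unitP diagP] := (codiagonalizableP As).1.
- split=> [_ _ /mapP[g _ ->] /mapP[h _ ->]|_ /mapP[g _ ->]].
    by rewrite /comm_mx -!repr_mxM ?in_setT // !FinRing.zmodMgE addrC.
  (* The minimal polynomial argument takes place in positive dimension; a 0 by 0 matrix is
     diagonal. *)
  case: n rG @As => [|n] rG As; first exists 1%:M; rewrite ?unitmx1 //.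
    by apply/is_diag_mxP => -[].
  apply/diagonalizableP; exists [seq z ^+ nat_of_ord i | i <- enum 'I_#|A|].
    rewrite map_inj_uniq ?enum_uniq // => i j /eqP.
    rewrite (eq_prim_root_expr prim_z) !modn_small // => /eqP.
    exact: val_inj.
  rewrite big_map big_enum /= -(big_mkord xpredT (fun i => 'X - (z ^+ i)%:P)).
  rewrite (factor_Xn_sub_1 prim_z); apply: mxminpoly_min.
  rewrite rmorphB rmorphXn rmorph1 /= horner_mx_X; apply/eqP; rewrite subr_eq0.
  suff repX k : rG g ^+ k = rG (g ^+ k)%g.
    by rewrite repX FinRing.zmodXgE mulrn_card repr_mx1.
  elim: k => [|k IH]; first by rewrite repr_mx1.
  by rewrite exprS expgS repr_mxM ?in_setT // IH.
have /fin_all_exists[D DE] g : exists D : 'rV[F]_n, P *m rG g = diag_mx D *m P.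
  have /(allP diagP)/diagonalizable_forPex[D simD] : rG g \in As.
    by apply: map_f; rewrite mem_enum.
  by exists D; apply: simmxPp simD; rewrite stablemx_unit.
have DP (D1 D2 : 'rV[F]_n) : diag_mx D1 *m P = diag_mx D2 *m P -> D1 = D2.
  move/(can_inj (mulmxK unitP))/matrixP => eqD; apply/rowP => i.
  by have := eqD i i; rewrite !mxE eqxx.
have [_ _ _ _ full] := pb.
have /fin_all_exists[a aE] i : exists x, (fun g => D g 0 i) =1 b x.
  apply: full => [|g h].
    have -> : D 0 = const_mx 1; last by rewrite mxE.
    by apply: DP; rewrite -DE repr_mx1 diag_const_mx mul1mx mulmx1.
  have -> : D (g + h) = \row_i (D g 0 i * D h 0 i); last by rewrite mxE.
  apply: DP; rewrite -DE -FinRing.zmodMgE repr_mxM ?in_setT //.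
  by rewrite mulmxA DE -mulmxA DE mulmxA mulmx_diag.
exists P, a; split=> // g; rewrite DE; congr (diag_mx _ *m _).
by apply/rowP => i; rewrite mxE aE.
Qed.

(** * Monomials in eigencoordinates *)

Section CoordinateMonomials.

Variables (F : fieldType) (n s : nat) (P : 'M[F]_n) (js : 'I_s -> 'I_n).
Variable m : 'I_s -> nat.

(** A monomial in the coordinates of [P *m v], written in the original variables; [js] selects
    coordinates, possibly with repetition. *)
Definition coord_monomial : {mpoly F[n]} :=
  \prod_j (\sum_l P (js j) l *: 'X_l) ^+ m j.

Lemma eval_coord_monomial v :
  eval_at coord_monomial v = monom_val (fun j => (P *m v) (js j) 0) m.
Proof.
rewrite /eval_at rmorph_prod; apply: eq_bigr => j _ /=.
rewrite rmorphXn raddf_sum /= mxE; congr (_ ^+ _); apply: eq_bigr => l _.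
by rewrite mevalZ mevalXU.
Qed.

Lemma coord_monomial_homog : coord_monomial \is (\sum_j m j).-homog.
Proof.
rewrite /coord_monomial; apply: (big_ind2 (fun p e => p \is e.-homog)).
- exact: dhomog1.
- by move=> p d q e; apply: dhomogM.
move=> j _; rewrite -[X in X.-homog]mul1n; apply: dhomogMn.
by apply: rpred_sum => l _; apply: dhomogZ; rewrite dhomogX /= mdeg1.
Qed.

End CoordinateMonomials.

(** * Helly's property and orbits *)

Lemma helly_dim_gt0 (gT : finGroupType) : (0 < helly_dim gT)%N.
Proof. by rewrite /helly_dim; case: ex_minnP => k /andP[]. Qed.

Lemma helly_dimP (gT : finGroupType) (X : {set {set gT}}) :
    (forall C, C \in X -> is_coset C) ->
    (forall Y : {set {set gT}}, Y \subset X -> (#|Y| <= helly_dim gT)%N ->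
       exists g, forall C, C \in Y -> g \in C) ->
  exists g, forall C, C \in X -> g \in C.
Proof.
rewrite /helly_dim; case: ex_minnP => k /andP[_ /forallP/(_ X) hellyX] _ cosX subX.
apply: NNPP => notX.
have premX : [forall C in X, is_coset C] && (\bigcap_(C in X) C == set0).
  apply/andP; split; first exact/forall_inP.
  apply/eqP/setP => g; rewrite [RHS]inE; apply/negP => /bigcapP gX.
  by apply: notX; exists g.
have /existsP[Y /and3P[sYX leYk /eqP Y0]] := implyP hellyX premX.
have [g gY] := subX Y sYX leYk.
have : g \in \bigcap_(C in Y) C by apply/bigcapP.
by rewrite Y0 inE.
Qed.

Lemma pairing_fiber_coset (F : fieldType) (A : finZmodType) (b : A -> A -> F)
    (x g : A) :
  perfect_pairing b -> is_coset [set h | b x h == b x g].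
Proof.
move=> [_ b0 bD _ _].
have kerP : group_set [set h | b x h == 1].
  apply/group_setP; split=> [|h h']; rewrite !inE.
    by rewrite -[X in b x X]/(0 : A) b0.
  by rewrite FinRing.zmodMgE bD => /eqP-> /eqP->; rewrite mulr1.
have nz_g : b x g != 0.
  apply: contra_eq_neq (b0 x) => bg0.
  by rewrite -(subrr g) bD bg0 mul0r eq_sym oner_neq0.
apply/existsP; exists (Group kerP); apply/existsP; exists g.
apply/eqP/setP => h; rewrite mem_lcoset !inE FinRing.zmodMgE FinRing.zmodVgE.
transitivity (b x (h - g) * b x g == 1 * b x g); first by rewrite -bD subrK mul1r.
by rewrite (inj_eq (mulIf nz_g)) addrC.
Qed.

Lemma relations_generated_ind (A : zmodType) k d s (a : s.-tuple A) m
    (H : {ffun 'I_s -> int} -> Prop) :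
    relations_generated A k d -> (0 < s <= k)%N -> uniq a -> is_subgroup H ->
    (forall c, relation_monoid a c -> ffun_length c <= d%:Z -> H c) ->
  relation_group a m -> H m.
Proof.
move=> genA s_le Ua sgH monH rel_m.
by apply: (proj1 (genA s a s_le Ua m) rel_m) => // c [mon_c len_c]; apply: monH.
Qed.

(* The linear system [b (a i) g = z i / y i], where i ranges over the support
   of y, is solved by Helly's property: a subsystem of at most [helly_dim]
   equations is consistent because all the multiplicative relations that its
   right-hand sides must satisfy follow from those of length at most d. *)
Lemma orbit_of_short_relations (F : fieldType) (A : finZmodType)
    (b : A -> A -> F) (zeta : F) (d n : nat) (a : 'I_n -> A) (y z : 'I_n -> F) :
    #|A|.-primitive_root zeta -> perfect_pairing b ->
    relations_generated A (helly_dim A) d ->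
    (forall s (js : 'I_s -> 'I_n) (m : 'I_s -> nat),
       nat_relation (a \o js) m -> (\sum_j m j <= d)%N ->
       monom_val (y \o js) m = monom_val (z \o js) m) ->
  exists g, forall i, z i = b (a i) g * y i.
Proof.
move=> prim_zeta pb genA yz.
(* Generation is applied to the one-term sequence a_i: were its order above d, its only nonnegative
   relation of length at most d would be 0, which does not generate the order. *)
have order_le i : (#[a i]%g <= d)%N.
  have [|//] := ltnP d #[a i]%g; move=> d_lt.
  pose H (m : {ffun 'I_1 -> int}) := m = 0.
  have s1 : (0 < 1 <= helly_dim A)%N by rewrite helly_dim_gt0.
  have U1 : uniq [tuple a i] by [].
  have : H (ffun_delta ord0 #[a i]%g).
    apply: (relations_generated_ind genA s1 U1) => [|m [m_ge0 rel_m] len_m|].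
    - by rewrite /H; split=> // u v -> ->; rewrite subrr.
    - apply/ffunP => j; rewrite [j]ord1 ffunE; move: rel_m len_m (m_ge0 ord0).
      rewrite /relation_group /ffun_length !big_ord1 (tnth_nth 0) /=.
      case: (m ord0) => // k /eqP; rewrite -pmulrn mulrn_eq0_order.
      case: k => // k /dvdn_leq ord_k k_d _.
      by have := leq_trans (ord_k isT) k_d; rewrite leqNgt d_lt.
    - by apply/relation_delta; rewrite -FinRing.zmodXgE expg_order.
  move/ffunP/(_ ord0); rewrite !ffunE eqxx => [[/eqP]].
  by rewrite -leqn0 leqNgt order_gt0.
have yz1 i : y i ^+ #[a i]%g = z i ^+ #[a i]%g.
  have := yz 1%N (fun=> i) (fun=> #[a i]%g).
  rewrite /nat_relation /monom_val !big_ord1; apply=> //=.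
  by rewrite -FinRing.zmodXgE expg_order.
have yz0 i : (y i == 0) = (z i == 0).
  have := congr1 (eq_op^~ 0) (yz1 i).
  by rewrite !expf_eq0 order_gt0.
pose u i := z i / y i.
have u_order i : y i != 0 -> u i ^+ #[a i]%g = 1.
  by move=> nz_y; rewrite expr_div_n -yz1 divff ?expf_neq0.
(* Generation concerns distinct elements, so coordinates of equal weight must have equal ratios.
   With o the order of a_i = a_j, the relation a_i + (o - 1) a_j = 0 of length o <= d gives u_i
   u_j^(o-1) = 1 = u_j^o. *)
have u_eq i j : y i != 0 -> y j != 0 -> a i = a j -> u i = u j.
  move=> nz_i nz_j eq_a; set o := #[a i]%g.
  have o_gt0 : (0 < o)%N by apply: order_gt0.
  have := yz 2%N (fun k => if k == ord0 then i else j)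
                 (fun k => if k == ord0 then 1%N else o.-1).
  rewrite /nat_relation /monom_val !big_ord_recl !big_ord0 /=.
  rewrite addr0 addn0 !mulr1 -eq_a -mulrnDr add1n prednK // => /(_ _ (order_le i)).
  rewrite -FinRing.zmodXgE expg_order => /(_ erefl) e.
  have uij : u i * u j ^+ o.-1 = 1.
    rewrite /u expr_div_n mulrACA -invfM -e divff //.
    by rewrite mulf_neq0 // expf_neq0.
  have nz_uj : u j ^+ o.-1 != 0.
    by apply: contra_eq_neq uij => ->; rewrite mulr0 eq_sym oner_neq0.
  apply: (mulIf nz_uj); rewrite uij -exprS prednK // /o eq_a u_order //.
have local s (js : 'I_s -> 'I_n) : (0 < s <= helly_dim A)%N ->
    injective (a \o js) -> (forall j, y (js j) != 0) ->
    exists g, forall j, b (a (js j)) g = u (js j).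
  move=> s_le inj_a nz_y; apply: (pairing_realizes prim_zeta pb) => m rel_m.
  have nz_u j : u (js j) != 0 by rewrite mulf_neq0 ?invr_eq0 // -yz0.
  pose t := [tuple a (js j) | j < s].
  have tE j : tnth t j = a (js j) by rewrite tnth_mktuple.
  have Ut : uniq t by apply/tuple_uniqP => j k; rewrite !tE; apply: inj_a.
  (* The exponents that are trivial at u form a subgroup, so short relations suffice; on those y and
     z have equal nonzero monomials, whose quotient is 1. *)
  pose H (k : {ffun 'I_s -> int}) := \prod_j u (js j) ^ k j = 1.
  suff : H [ffun j => (m j)%:Z].
    rewrite /H => e; rewrite -[RHS]e; apply: eq_bigr => j _.
    by rewrite ffunE.
  apply: (relations_generated_ind genA s_le Ut) => [|k [k_ge0 rel_k] len_k|].
  - rewrite /H; split=> [|k l k1 l1]; first by apply: big1 => j _; rewrite ffunE.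
    transitivity (\prod_j (u (js j) ^ k j / u (js j) ^ l j)).
      apply: eq_bigr => j _.
      by rewrite !ffunE expfzDr // invr_expz.
    by rewrite big_split /= prodfV k1 l1 divr1.
  - pose k' j := `|k j|%N.
    have kE j : k j = k' j by rewrite gez0_abs.
    have : monom_val (y \o js) k' = monom_val (z \o js) k'.
      apply: yz.
        rewrite /nat_relation -[RHS]rel_k; apply: eq_bigr => j _.
        by rewrite kE tE.
      suff e : ffun_length k = (\sum_j k' j)%N :> int by rewrite e in len_k.
      by rewrite (big_morph Posz PoszD erefl); apply: eq_bigr.
    rewrite /monom_val => e.
    transitivity (\prod_j (z (js j) ^+ k' j / y (js j) ^+ k' j)).
      by apply: eq_bigr => j _; rewrite kE -exprnP expr_div_n.
    rewrite big_split /= prodfV -e divff //.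
    by apply/prodf_neq0 => j _; apply/expf_neq0/nz_y.
  - rewrite /relation_group -[RHS]rel_m; apply: eq_bigr => j _.
    by rewrite ffunE tE.
pose C i := [set g | b (a i) g == u i].
have [||g gC] := helly_dimP (X := [set C i | i in [pred i | y i != 0]]).
- move=> _ /imsetP[i nz_y ->].
  (* A single equation is solvable, so [C i] is a nonempty fibre of a character, hence a coset of
     its kernel. *)
  have [||g /(_ ord0) gP] := local 1%N (fun=> i) _ _ (fun=> nz_y).
  + exact: helly_dim_gt0.
  + by move=> j k _; rewrite [j]ord1 [k]ord1.
  by rewrite /C -gP; apply: pairing_fiber_coset.
- move=> Y /subsetP sYX leY.
  have [Y0|Y_gt0] := posnP #|Y|.
    by exists 0 => D; rewrite (cards0_eq Y0) inE.
  have /fin_all_exists[js jsP] (j : 'I_#|Y|) :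
      exists i, y i != 0 /\ enum_val j = C i.
    by have /sYX/imsetP[i nz_y ->] := enum_valP j; exists i.
  have [||g gP] := local _ js _ _ (fun j => (jsP j).1).
  + by rewrite Y_gt0.
  (* One index is chosen for each coset in [Y]; by [u_eq], equal weights would give equal cosets, so
     the chosen weights are distinct. *)
  + move=> j k /= eq_a; apply: enum_val_inj; rewrite !(jsP _).2.
    have [[nz_j _] [nz_k _]] := (jsP j, jsP k).
    by rewrite /C eq_a (u_eq _ _ nz_j nz_k eq_a).
  exists g => D YD; rewrite -(enum_rankK_in YD YD) (jsP _).2 inE gP.
  exact: eqxx.
exists g => i; have [y0|nz_y] := eqVneq (y i) 0.
  by rewrite y0 mulr0; apply/eqP; rewrite -yz0 y0.
have /gC : C i \in [set C i | i in [pred i | y i != 0]] by apply: imset_f.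
by rewrite inE => /eqP->; rewrite divfK.
Qed.

Lemma separating_of_relations_generated (F : fieldType) (A : finZmodType)
    (b : A -> A -> F) (z : F) (d n : nat) (rG : mx_representation F [set: A] n) :
    #|A|.-primitive_root z -> perfect_pairing b ->
    relations_generated A (helly_dim A) d ->
  has_separating_set_of_degree rG d.
Proof.
move=> prim_z pb genA; have [bC b0 _ _ _] := pb.
have [P [a [unitP rGP]]] := diagonalize_repr rG prim_z pb.
have coordE g v i : (P *m (rG g *m v)) i 0 = b (a i) g * (P *m v) i 0.
  by rewrite mulmxA rGP -mulmxA mul_diag_mx !mxE.
(* All homogeneous invariants of degree at most d are taken; two vectors on which they agree turn
   out to lie in one orbit. *)
exists (fun f => invariant_poly rG f /\ exists2 e, (e <= d)%N & f \is e.-homog).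
split=> [|f []//]; split=> [f []//|v w vw h inv_h].
have [s js m rel_m m_le|g wE] := orbit_of_short_relations (a := a)
    (y := fun i => (P *m v) i 0) (z := fun i => (P *m w) i 0) prim_z pb genA.
  have := vw (coord_monomial P js m); rewrite !eval_coord_monomial; apply.
  split=> [g x _|]; last by exists (\sum_j m j)%N; rewrite ?coord_monomial_homog.
  rewrite !eval_coord_monomial /monom_val.
  under eq_bigr => j _ do rewrite coordE exprMn.
  by rewrite big_split /= -(pairing_sum _ _ _ pb) [X in b X]rel_m bC b0 mul1r.
have -> : w = rG g *m v; last by rewrite inv_h ?in_setT.
apply: (can_inj (mulKmx unitP)); apply/matrixP => i j.
by rewrite [j]ord1 coordE wE.
Qed.

(** Modulo the short relations #|A| e_i, every relation has entries in [0, #|A|), hence length at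
    most k #|A|. The factor [k.+1] keeps the bound positive, and at least #|A|, when k = 0. *)
Lemma relations_generated_exists (A : finZmodType) k :
  exists2 d, (0 < d)%N & relations_generated A k d.
Proof.
have A_gt0 : (0 < #|A|)%N by apply/card_gt0P; exists 0.
exists (k.+1 * #|A|)%N => [|s a /andP[s_gt0 s_le] _ m]; first by rewrite muln_gt0.
split=> [rel_m|]; last exact: short_relations_sub.
have [l [l_lt rel_l lE]] := relation_residues rel_m.
have sg : is_subgroup (short_relations a (k.+1 * #|A|)).
  exact: generated_is_subgroup.
apply: (subgroup_congr sg (N := #|A|) (m := [ffun i => (l i)%:Z])) => [i|i|].
- apply: short_delta; apply: leq_trans (leq_pmull _ _) => //.
  by rewrite dvdn_leq // -mulrn_eq0_order mulrn_card.
- by rewrite ffunE.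
apply: short_nat_relation => //.
apply: (@leq_trans (\sum_(i < s) #|A|)%N).
  by apply: leq_sum => i _; apply: ltnW.
by rewrite sum_nat_const card_ord leq_mul2r (leqW s_le) orbT.
Qed.

(** * Least bounds and the comparison of the two minima *)

Lemma min_positive_exists (P : nat -> Prop) d :
  (0 < d)%N -> P d -> exists2 e, min_positive P e & (e <= d)%N.
Proof.
have [k] := ubnP d; elim: k d => // k IH d le_dk d_gt0 Pd.
have [[e [e_gt0 Pe lt_ed]]|no_e] :=
    classic (exists e, [/\ (0 < e)%N, P e & (e < d)%N]).
  have [c minc le_ce] := IH e (leq_trans lt_ed le_dk) e_gt0 Pe.
  by exists c => //; apply: leq_trans le_ce (ltnW lt_ed).
exists d => //; split=> // e e_gt0 Pe; rewrite leqNgt; apply/negP => lt_ed.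
by apply: no_e; exists e.
Qed.

Lemma beta_sep_boundE (F : fieldType) (gT : finGroupType) (G : {group gT}) d :
  beta_sep_bound F G d <->
  (0 < d)%N /\ forall n (rG : mx_representation F G n),
                 has_separating_set_of_degree rG d.
Proof.
split=> [bnd|[d_gt0 sep_d] n rG]; last exact: min_positive_exists.
have sep_d n (rG : mx_representation F G n) :
    (0 < d)%N /\ has_separating_set_of_degree rG d.
  have [e [e_gt0 [S [sepS degS]] _] le_ed] := bnd n rG.
  split; first exact: leq_trans le_ed.
  exists S; split=> // f /degS[c le_ce homf].
  by exists c => //; apply: leq_trans le_ce le_ed.
split=> [|n rG]; last by have [] := sep_d n rG.
(* Positivity of [d] is read off from one module, the regular representation. *)
by have [] := sep_d _ (regular_repr F G).
Qed.

Theorem corollary2p6 (G : finZmodType) (F : closedFieldType)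
    (charF : forall p : nat, p \in [pchar F]%R -> ~~ (p %| #|G|)%N) :
  (exists d : nat, is_beta_sep F [set: G]%G d) /\
  (forall d : nat,
     is_beta_sep F [set: G]%G d <->
     min_positive (relations_generated G (helly_dim G)) d).
Proof.
have nz_G : #|G|%:R != 0 :> F.
  apply/negP => G0; have G_gt0 : (0 < #|G|)%N by apply/card_gt0P; exists 0.
  have [p pF] := natf0_pchar G_gt0 G0.
  by have := charF p pF; rewrite (dvdn_pcharf pF) G0.
have [z prim_z] := closed_prim_root nz_G.
have [b pb] := perfect_pairing_exists prim_z.
(* The upper bounds of the module invariants are exactly the positive d for which short relations
   generate, so the least elements coincide. *)
have boundE d : beta_sep_bound F [set: G]%G d <->
    (0 < d)%N /\ relations_generated G (helly_dim G) d.
  rewrite beta_sep_boundE; split=> -[d_gt0 genG]; split=> //.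
    move=> s a _ _ m; split; last exact: short_relations_sub.
    exact: relations_generated_of_separating prim_z pb nz_G genG.
  by move=> n rG; apply: separating_of_relations_generated prim_z pb genG.
have betaE d : is_beta_sep F [set: G]%G d <->
    min_positive (relations_generated G (helly_dim G)) d.
  split=> [[/boundE[d_gt0 gen_d] min_d]|[d_gt0 gen_d min_d]]; split=> //.
  - by move=> e e_gt0 gen_e; apply/min_d/boundE.
  - exact/boundE.
  - by move=> e /boundE[]; apply: min_d.
split=> //; have [d d_gt0 gen_d] := relations_generated_exists G (helly_dim G).
by have [e /betaE] := min_positive_exists d_gt0 gen_d; exists e.
Qed.
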